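(* For every $\varepsilon > 0$, there exists a $1$-tough chordal planar graph $G$ whose longest path has less than $|V(G)|^{\varepsilon}$ vertices.
   Context: All graphs are finite and simple. The toughness of a graph $G$ is the minimum, taken over all separating sets $X$ of vertices of $G$ (sets such that $G-X$ is disconnected), of the ratio of $|X|$ to the number of components of $G-X$; the toughness of a complete graph is defined as infinite. A graph is $t$-tough if its toughness is at least $t$. *)

(* Defs.v *)
From HB Require Import structures.
From mathcomp Require Import all_boot all_order all_algebra.
From mathcomp Require Import all_classical all_reals all_analysis.

Set Implicit Arguments.
Unset Strict Implicit.
Unset Printing Implicit Defensive.

Import Order.TTheory GRing.Theory Num.Theory.
Import numFieldNormedType.Exports.

Local Open Scope classical_set_scope.
Local Open Scope ring_scope.

Record sgraph := SGraph {
  vertex :> finType;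
  edge : rel vertex;
  edge_sym : symmetric edge;
  edge_irrefl : irreflexive edge }.

Section Induced.
Variables (G : sgraph) (A : {set G}).

Definition induced_edge : rel {x : G | x \in A} :=
  fun x y => edge (val x) (val y).

Lemma induced_edge_sym : symmetric induced_edge.
Proof. by move=> x y; rewrite /induced_edge edge_sym. Qed.

Lemma induced_edge_irrefl : irreflexive induced_edge.
Proof. by move=> x; rewrite /induced_edge edge_irrefl. Qed.

Definition induced : sgraph := SGraph induced_edge_sym induced_edge_irrefl.

End Induced.

Definition graph_minus (G : sgraph) (X : {set G}) : sgraph := induced (~: X)%SET.

Definition connected_graph (G : sgraph) : bool :=
  [forall x : G, forall y : G, connect (@edge G) x y].

Definition num_components (G : sgraph) : nat := n_comp (@edge G) predT.

Definition separating (G : sgraph) (X : {set G}) : bool :=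
  ~~ connected_graph (graph_minus X).

(* A complete graph has no separating set, so that the minimum is then the
   default value +oo. The empty set separates a disconnected graph, whose
   toughness is therefore 0. *)
Definition toughness (R : realType) (G : sgraph) : \bar R :=
  \big[Order.min/+oo%E]_(X : {set G} | separating X)
    (#|X|%:R / (num_components (graph_minus X))%:R)%:E.

Definition tough (R : realType) (t : R) (G : sgraph) : Prop :=
  (t%:E <= toughness R G)%E.

Definition is_cycle (G : sgraph) (c : seq G) : bool :=
  [&& (2 < size c)%N, cycle (@edge G) c & uniq c].

Definition chord (G : sgraph) (c : seq G) (x y : G) : bool :=
  [&& x \in c, y \in c, edge x y, y != next c x & x != next c y].

Definition chordal (G : sgraph) : Prop :=
  forall c : seq G, is_cycle c -> (3 < size c)%N ->
    exists x y : G, chord c x y.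

Definition edges (G : sgraph) : {set {set G}} :=
  [set [set p.1; p.2]%SET | p : G * G & edge p.1 p.2]%SET.

Definition is_arc (R : realType) (A : set (R * R)) (a b : R * R) : Prop :=
  exists g : R -> R * R,
    [/\ {within `[0, 1], continuous g}, {in `[0, 1] &, injective g},
        g 0 = a, g 1 = b & A = g @` `[0, 1]].

(* The vertex x is drawn as the point pos x and the edge e as the arc
   curve e, endpoints included; the values of curve outside edges G play
   no role. *)
Definition plane_drawing (R : realType) (G : sgraph)
    (pos : G -> R * R) (curve : {set G} -> set (R * R)) : Prop :=
  [/\ injective pos,
      forall x y : G, edge x y ->
        is_arc (curve [set x; y]%SET) (pos x) (pos y),
      forall (e : {set G}) (z : G), e \in edges G ->
        curve e (pos z) -> z \in e
    & forall e f : {set G}, e \in edges G -> f \in edges G -> e != f ->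
        curve e `&` curve f `<=` pos @` [set` (e :&: f)%SET]].

Definition planar (R : realType) (G : sgraph) : Prop :=
  exists (pos : G -> R * R) (curve : {set G} -> set (R * R)),
    plane_drawing pos curve.

(* The empty sequence is allowed; it only matters for the graph without
   vertices, whose longest path thus has 0 vertices. *)
Definition is_path (G : sgraph) (p : seq G) : bool :=
  sorted (@edge G) p && uniq p.

Definition longest_path_order (G : sgraph) : nat :=
  \max_(k < #|G|.+1 | [exists p : k.-tuple G, is_path p]) k.

(* Main.v *)
Require Import Defs.
From HB Require Import structures.
From mathcomp Require Import all_boot all_order all_algebra.
From mathcomp Require Import all_classical all_reals all_analysis.
From mathcomp Require Import zify ring lra.

Set Implicit Arguments.
Unset Strict Implicit.
Unset Printing Implicit Defensive.

Import Order.TTheory GRing.Theory Num.Theory.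
Import numFieldNormedType.Exports.

(** Let N be the line graph of a complete binary tree with a pendant edge at
    the root, and let G be N together with a vertex, the hub, joined to
    everything. Naming each edge of the tree by its lower end, numbered as in a
    binary heap, the vertices of N are the positive integers below 2 ^ h: the
    neighbours of i are its parent i./2, its sibling and its children. The hub
    is number 0, which is consistently the parent of 1.

    Toughness. Removing k edges from a tree leaves at most k + 1 components, so
    removing the hub and k vertices of N leaves at most k + 1; without removing
    the hub nothing is separated. Concretely, when the hub is in X, every
    component of G - X has a vertex whose parent is in X, and that parent
    determines the component, because siblings are adjacent
    ([heap_num_components]).

    Chordality. The neighbours of i that are smaller than i are among 0, i./2
    and the sibling of i, which are pairwise adjacent, so the largest vertex of
    a long cycle has its two cycle neighbours joined by a chord
    ([heap_chordal]).

    Short paths. N is a tree of triangles {i, 2 i, 2 i + 1}. A path in N goes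
    up, then down, with at most one sideways step per level in each phase, so
    it has O(h) vertices ([nonroot_path_size]). A path of G uses the hub at
    most once, so it also has O(h) vertices ([heap_path_size]), which is
    logarithmic in the order 2 ^ h of G.

    Planarity. N is outerplanar: its vertices can be ordered along a line so
    that no two edges interleave, by inserting 2 k and 2 k + 1 immediately after
    k ([heap_layout_exists]). Placing them in this order on the arc
    y = x ^ 2, 0 <= x < 1, keeps the chords from crossing; the hub at (0, -1) sees
    this arc from below, so that its straight edges cross neither each other nor
    the chords ([heap_crossing]). *)

Local Open Scope nat_scope.

(** * The graph *)

(** As 0 is the parent and the sibling of 1 but must be adjacent to everything,
    it gets its own clauses; on positive integers they are vacuous. *)
Definition heap_adj : rel nat := fun i j =>
  (i != j) && [|| i == 0, j == 0, i./2 == j, j./2 == i | i./2 == j./2].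

Lemma heap_adj_sym : symmetric heap_adj.
Proof. by move=> i j; rewrite /heap_adj; lia. Qed.

Lemma heap_adj_irrefl : irreflexive heap_adj.
Proof. by move=> i; rewrite /heap_adj eqxx. Qed.

Lemma ord_heap_adj_sym n : symmetric (fun i j : 'I_n => heap_adj i j).
Proof. by move=> i j; apply: heap_adj_sym. Qed.

Lemma ord_heap_adj_irrefl n : irreflexive (fun i j : 'I_n => heap_adj i j).
Proof. by move=> i; apply: heap_adj_irrefl. Qed.

Definition heap_graph (n : nat) : sgraph :=
  SGraph (@ord_heap_adj_sym n) (@ord_heap_adj_irrefl n).

(** * Paths *)

(** A path that has just stepped from x down to its child y cannot return
    through x, and the triangle of x and its children is the only way out of the
    part below x. So it continues down, possibly after one step to the sibling:
    at most two vertices per level, of which at most k lie below x. *)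
Lemma descending_path_size (n k x y : nat) (s : seq nat) :
  0 < x -> y./2 = x -> y < n -> n <= x * 2 ^ k ->
  path heap_adj y s -> uniq [:: x, y & s] -> all (fun z => 0 < z < n) s ->
  size s <= k.*2.
Proof.
elim/ltn_ind: k x y s => k IH x y s x0 yx yn nk.
(* After a further step down, from u to v, one level fewer is left. *)
have {}IH u v r : x.*2 <= u -> v./2 = u -> v < n -> path heap_adj v r ->
    uniq [:: u, v & r] -> all (fun z => 0 < z < n) r -> (size r).+2 <= k.*2.
  case: k IH nk => [|k] IH nk yu vu vn pr ur ar.
    by move: nk; rewrite expn0 muln1; lia.
  have := IH k (ltnSn k) u v r; rewrite doubleS !ltnS; apply=> //; first by lia.
  rewrite (leq_trans nk)// expnS mulnA leq_mul2r; apply/orP; right; lia.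
have k0 : 0 < k.
  by case: k nk {IH} => // nk; move: nk; rewrite expn0 muln1; lia.
case: s => [//|z s] /= /andP[yz zs] /and3P[]; rewrite !inE !negb_or.
move=> /and3P[xy xz xs] /andP[yz' ys] /andP[zs' us] /andP[/andP[z0 zn] sn].
have [zy|zy] := eqVneq z./2 y.
  have := IH y z s _ zy zn zs.
  rewrite /= inE negb_or yz' ys zs' us => /(_ _ isT sn) H.
  by have := H ltac:(lia); lia.
have {zy}zx : z./2 = x by move: yz; rewrite /heap_adj; lia.
case: s zs ys zs' us sn xs => [_ _ _ _ _ _|w s] /=; first by lia.
move=> /andP[zw ws]; rewrite !inE !negb_or => /andP[yw ys] /andP[zw' zs].
move=> /andP[ws' us] /andP[/andP[w0 wn] sn] /andP[xw xs].
have wz : w./2 = z by move: zw; rewrite /heap_adj; lia.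
have := IH z w s _ wz wn ws.
rewrite /= inE negb_or zw' zs ws' us => /(_ _ isT sn) H.
by have := H ltac:(lia); lia.
Qed.

(** While the path only goes up and sideways it has at most two vertices per
    level, of which at most k are at or above x, as two consecutive sideways
    steps would revisit a vertex. Its first step down starts a descending path. *)
Lemma nonroot_path_size (h k x : nat) (s : seq nat) :
  0 < x < 2 ^ k -> path heap_adj x s -> uniq (x :: s) ->
  all (fun z => 0 < z < 2 ^ h) s ->
  size s <= k.*2 + h.*2 + 2.
Proof.
elim/ltn_ind: k x s => k IH x s /andP[x0 xk].
have {}IH u r : 0 < u -> u.*2 <= x -> path heap_adj u r -> uniq (u :: r) ->
    all (fun z => 0 < z < 2 ^ h) r -> size r <= k.*2 + h.*2.
  case: k IH xk => [|k] IH xk u0 ux pr ur ar.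
    by move: xk; rewrite expn0; lia.
  have uk : 0 < u < 2 ^ k by rewrite u0 /=; move: xk; rewrite expnS; lia.
  by have := IH k (ltnSn k) u r uk pr ur ar; lia.
have down u v r : 0 < u -> v./2 = u -> v < 2 ^ h -> path heap_adj v r ->
    uniq [:: u, v & r] -> all (fun z => 0 < z < 2 ^ h) r -> size r <= h.*2.
  move=> u0 vu vn pr ur ar; apply: (descending_path_size u0 vu vn _ pr ur ar).
  exact: leq_pmull.
case: s => [//|z s] /= /andP[xz zs] /and3P[]; rewrite inE negb_or.
move=> /andP[xz' xs] zs' us /andP[/andP[z0 zn] sn].
have [zx|zx] := eqVneq z./2 x.
  have := down x z s x0 zx zn zs.
  by rewrite /= inE negb_or xz' xs zs' us => /(_ isT sn); lia.
have [xz2|xz2] := eqVneq x./2 z.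
  have := IH z s z0 _ zs; rewrite /= zs' us => /(_ _ isT sn) H.
  by have := H ltac:(lia); lia.
have {zx xz2}zx : z./2 = x./2 by move: xz; rewrite /heap_adj; lia.
case: s zs zs' us sn xs => [_ _ _ _ _|w s] /=; first by lia.
move=> /andP[zw ws]; rewrite !inE !negb_or => /andP[zw' zs].
move=> /andP[ws' us] /andP[/andP[w0 wn] sn] /andP[xw xs].
have [wz|wz] := eqVneq w./2 z.
  have := down z w s z0 wz wn ws.
  by rewrite /= inE negb_or zw' zs ws' us => /(_ isT sn); lia.
have {wz}wx : z./2 = w by move: zw; rewrite /heap_adj; lia.
have := IH w s w0 _ ws; rewrite /= ws' us => /(_ _ isT sn) H.
by have := H ltac:(lia); lia.
Qed.

(** Removing 0 cuts the path into at most two paths on positive integers, each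
    starting at depth at most h. *)
Lemma heap_path_size (h : nat) (p : seq nat) :
  sorted heap_adj p -> uniq p -> all (fun z => z < 2 ^ h) p ->
  size p <= 8 * h + 7.
Proof.
have nonroot q : sorted heap_adj q -> uniq q -> all (fun z => z < 2 ^ h) q ->
    0 \notin q -> size q <= 4 * h + 3.
  case: q => [//|x s] /= xs us /andP[xh sh]; rewrite inE negb_or => /andP[x0 s0].
  have xh' : 0 < x < 2 ^ h by rewrite xh andbT; lia.
  have sh' : all (fun z => 0 < z < 2 ^ h) s.
    apply/allP => z zs; rewrite (allP sh _ zs) andbT lt0n.
    by apply: contraNneq s0 => <-.
  by have := nonroot_path_size xh' xs us sh'; lia.
move=> sp up ap; have [p0|p0] := boolP (0 \in p); last first.
  by have := nonroot p sp up ap p0; lia.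
case/splitPr: p0 sp up ap => p1 p2.
move=> /cat_sorted2[sp1 /path_sorted sp2]; rewrite cat_uniq all_cat /=.
move=> /and4P[up1]; rewrite negb_or => /andP[n1 _] n2 up2 /and3P[ap1 _ ap2].
have := nonroot p1 sp1 up1 ap1 n1; have := nonroot p2 sp2 up2 ap2 n2.
by rewrite size_cat /=; lia.
Qed.

Lemma heap_longest_path (h : nat) :
  longest_path_order (heap_graph (2 ^ h)) <= 8 * h + 7.
Proof.
apply/bigmax_leqP => k /existsP[p /andP[sp up]].
have <- : size (map val p) = k by rewrite size_map size_tuple.
apply: heap_path_size.
- by rewrite sorted_map.
- by rewrite map_inj_uniq//; apply: val_inj.
- by apply/allP => _ /mapP[x _ ->]; apply: ltn_ord.
Qed.

(** * Chordality *)

(** The chord joins the two neighbours y and z on the cycle of its largest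
    vertex x. *)
Lemma heap_chordal (n : nat) : chordal (heap_graph n).
Proof.
move=> c /and3P[_ cc uc] sc; have uc0 := uc.
have [x0 x0c] : exists x, x \in c.
  by case: c sc {cc uc uc0} => // x c _; exists x; rewrite mem_head.
case: (@arg_maxnP _ x0 (mem c) val x0c) => x /= xc xmax.
have [i s Es] := rot_to xc.
have memE z : (z \in c) = (z \in x :: s) by rewrite -Es mem_rot.
have nextE z : next c z = next (x :: s) z by rewrite -Es next_rot.
have {}cc : cycle (@edge (heap_graph n)) (x :: s) by rewrite -Es rot_cycle.
have {}uc : uniq (x :: s) by rewrite -Es rot_uniq.
have {}sc : 3 < size (x :: s) by rewrite -Es size_rot.
have {}xmax z : z \in s -> z < x.
  move=> zs; rewrite ltn_neqAle xmax ?memE ?inE ?zs ?orbT// andbT.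
  by apply: contraTneq zs => /val_inj ->; move: uc => /= /andP[].
case: s {Es} sc uc cc memE nextE xmax => [//|y s] sc uc cc memE nextE xmax.
case/lastP: s sc uc cc memE nextE xmax => [//|s z] sc uc cc memE nextE xmax.
have yx : y < x by apply: xmax; rewrite mem_head.
have zx : z < x by apply: xmax; rewrite inE mem_rcons mem_head orbT.
move: cc; rewrite /= rcons_path last_rcons /= => /and3P[xy _ xz].
have yz : y != z.
  by move: uc; rewrite /= mem_rcons inE negb_or => /and3P[_ /andP[]].
have next_x : next c x = y by rewrite nextE /= eqxx.
have next_y : next c y != z.
  have xney : y != x.
    by rewrite eq_sym; move: uc; rewrite /= inE negb_or => /andP[/andP[]].
  case: s sc uc {memE xmax xz} nextE => [//|w s] _ uc ->.
  rewrite /= (negbTE xney) eqxx.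
  by move: uc; rewrite /= mem_rcons inE negb_or => /and4P[_ _ /andP[]].
exists y, z; apply/and5P; split.
- by rewrite memE inE mem_head orbT.
- by rewrite memE !inE mem_rcons mem_head !orbT.
- move: xy xz yx zx yz; rewrite /edge /= /heap_adj -!(inj_eq val_inj) /=; lia.
- by rewrite eq_sym.
- rewrite -next_x (inj_eq (can_inj (prev_next uc0))).
  by apply: contraTneq zx => ->; rewrite ltnn.
Qed.

(** * Toughness *)

(** Going from x to its parent repeatedly decreases x, and 0 is in X, so the
    walk is stopped by X. *)
Lemma heap_component_exit (n : nat) (X : {set heap_graph n})
    (x : graph_minus X) :
  (exists2 z, z \in X & val z == 0 :> nat) ->
  exists y : graph_minus X,
    connect (@edge _) x y /\ exists2 z, z \in X & val z = (val (val y))./2.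
Proof.
move=> [z0 z0X /eqP z0E].
have [m] := ubnP (val (val x)); elim: m x => // m IH x; rewrite ltnS => xm.
have xX : val x \notin X by have := valP x; rewrite inE.
have x0 : 0 < val (val x).
  rewrite lt0n; apply: contraNneq xX => xE.
  by rewrite (_ : val x = z0)//; apply: val_inj; rewrite xE z0E.
have hn : (val (val x))./2 < n by have := ltn_ord (val x); simpl; lia.
have [hX|hX] := boolP (Ordinal hn \in X).
  by exists x; split; [exact: connect0|exists (Ordinal hn)].
have hX' : (Ordinal hn : heap_graph n) \in ~: X by rewrite inE.
have [|y [xy ysub]] := IH (Sub (Ordinal hn : heap_graph n) hX').
  by move: x0 xm; rewrite SubK /=; set k := nat_of_ord _; lia.
exists y; split=> //; apply: connect_trans xy; apply: connect1.
move: x0; rewrite /= /induced_edge /= /heap_adj /=.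
by set k := nat_of_ord _; lia.
Qed.

(** The parent in X of the exit vertex of a component determines the component:
    two exit vertices with the same parent are equal or adjacent siblings. *)
Lemma heap_num_components (n : nat) (X : {set heap_graph n}) :
  (exists2 z, z \in X & val z == 0 :> nat) ->
  num_components (graph_minus X) <= #|X|.
Proof.
move=> X0.
have csym : connect_sym (@edge (graph_minus X)).
  exact: sym_connect_sym (@edge_sym _).
have /choice[exit exitP] := fun x => heap_component_exit x X0.
have /choice[up upP] : forall x : graph_minus X, exists z,
    z \in X /\ val z = (val (val (exit x)))./2.
  by move=> x; have [_ [z]] := exitP x; exists z.
have up_inj : {in [pred x | roots (@edge (graph_minus X)) x] &, injective up}.
  move=> x y; rewrite !inE => /eqP rx /eqP ry xy.
  have half_eq : (val (val (exit x)))./2 = (val (val (exit y)))./2.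
    by have [_ <-] := upP x; have [_ <-] := upP y; rewrite xy.
  rewrite -rx -ry; apply/(fingraph.rootP csym).
  apply: connect_trans (proj1 (exitP x)) _; rewrite csym.
  apply: connect_trans (proj1 (exitP y)) _; rewrite csym.
  have [->|xney] := eqVneq (exit x) (exit y); first exact: connect0.
  apply: connect1; rewrite /edge /= /induced_edge /edge /= /heap_adj half_eq eqxx.
  rewrite !orbT andbT; apply: contraNneq xney => /val_inj E.
  by apply/eqP/val_inj.
rewrite /num_components /n_comp_mem.
rewrite (eq_card (_ : _ =i roots (@edge (graph_minus X)))); last first.
  by move=> x; rewrite !inE andbT.
rewrite -(card_in_image up_inj); apply: subset_leq_card.
by apply/fintype.subsetP => _ /fintype.imageP[x _ ->]; have [] := upP x.
Qed.

Lemma num_components_gt0 (G : sgraph) (x : G) : 0 < num_components G.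
Proof.
apply/card_gt0P; exists (fingraph.root (@edge G) x).
rewrite !inE andbT; apply: roots_root.
exact: sym_connect_sym (@edge_sym G).
Qed.

Lemma heap_tough (R : realType) (n : nat) : tough (1 : R) (heap_graph n).
Proof.
apply: le_bigmin => [|X sepX]; first exact: leey.
have csym : connect_sym (@edge (graph_minus X)).
  exact: sym_connect_sym (@edge_sym _).
have X0 : exists2 z, z \in X & val z == 0 :> nat.
  have [/existsP[z /andP[]]|] := boolP [exists z, (z \in X) && (val z == 0 :> nat)].
    by exists z.
  rewrite negb_exists => /forallP X0; case/negP: sepX.
  apply/forallP => x; apply/forallP => y.
  have n0 : 0 < n by case: (n) (val x) => // -[].
  have z0X : (Ordinal n0 : heap_graph n) \in ~: X.
    by rewrite inE; have := X0 (Ordinal n0); rewrite /= andbT.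
  pose z0 : graph_minus X := Sub (Ordinal n0 : heap_graph n) z0X.
  have z0conn u : connect (@edge _) z0 u.
    have [<-|zu] := eqVneq z0 u; first exact: connect0.
    apply: connect1; rewrite /= /induced_edge /= /heap_adj /= andbT.
    by apply: contraNneq zu => E; apply/eqP/val_inj/val_inj.
  by apply: connect_trans (z0conn y); rewrite csym.
rewrite lee_fin ler_pdivlMr ?ltr0n ?mul1r ?ler_nat.
  exact: heap_num_components.
by have /forallPn[x _] := sepX; apply: (num_components_gt0 x).
Qed.

(** * The order of magnitude *)

Lemma linear_lt_exp2 (a : nat) : 9 <= a -> exists2 g, 0 < g & a * g < 2 ^ g.
Proof.
move=> a9; exists (3 * a); first by lia.
apply: (@leq_trans (a.+1 * (a.+1 * a.+1))); first by nia.
have a2 : a.+1 <= 2 ^ a by apply: ltn_expl.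
have -> : 3 * a = a + (a + a) by lia.
by rewrite !expnD !leq_mul.
Qed.

Local Open Scope ring_scope.

(** * Segments between an apex and a parabola *)

Definition segment (R : realType) (a b : R * R) : set (R * R) :=
  [set q | exists2 s : R, 0 <= s <= 1 &
    q = ((1 - s) * a.1 + s * b.1, (1 - s) * a.2 + s * b.2)].

Lemma segmentC (R : realType) (a b : R * R) : segment a b = segment b a.
Proof.
suff sub (u v : R * R) : (segment u v `<=` segment v u)%classic.
  by apply/seteqP; split; apply: sub.
move=> _ [s /andP[s0 s1] ->]; exists (1 - s); first by lra.
by congr pair; ring.
Qed.

Lemma convex_combination_continuous (R : realType) (a b : R) :
  continuous (fun s : R => (1 - s) * a + s * b).
Proof.
move=> s; apply: cvgD; (apply: cvgM; last exact: cvg_cst).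
  by apply: cvgB; [exact: cvg_cst|exact: cvg_id].
exact: cvg_id.
Qed.

Lemma segment_arc (R : realType) (a b : R * R) :
  a != b -> is_arc (segment a b) a b.
Proof.
case: a b => [a1 a2] [b1 b2] ab.
exists (fun s => ((1 - s) * a1 + s * b1, (1 - s) * a2 + s * b2)); split.
- apply: continuous_subspaceT => s.
  exact: (cvg_pair (@convex_combination_continuous R a1 b1 s)
                   (@convex_combination_continuous R a2 b2 s)).
- move=> s r _ _ [E1 E2]; apply/eqP; apply: contraNT ab => sr.
  have sr0 : s - r != 0 by rewrite subr_eq0.
  have D1 : (s - r) * (b1 - a1) = 0 by lra.
  have D2 : (s - r) * (b2 - a2) = 0 by lra.
  move/eqP: D1; rewrite mulf_eq0 (negbTE sr0) subr_eq0 /= => /eqP ->.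
  by move/eqP: D2; rewrite mulf_eq0 (negbTE sr0) subr_eq0 /= => /eqP ->.
- by congr pair; ring.
- by congr pair; ring.
- apply/seteqP; split=> q.
  + by move=> [s s01 ->]; exists s => //; rewrite /= in_itv.
  + by move=> [s /=]; rewrite in_itv /= => s01 <-; exists s.
Qed.

Definition parabola (R : realType) (x : R) : R * R := (x, x ^+ 2).

Definition apex (R : realType) : R * R := (0, -1).

Lemma apex_neq_parabola (R : realType) (x : R) : apex R <> parabola x.
Proof. by case=> _ E; have := sqr_ge0 x; rewrite -E; lra. Qed.

(** The lines from the apex tangent to the parabola touch it at abscissas -1
    and 1, so for abscissas in [0, 1) distinct spokes have distinct directions. *)
Lemma spoke_spoke (R : realType) (x y : R) (q : R * R) :
  0 <= x < 1 -> 0 <= y < 1 -> x != y ->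
  segment (apex R) (parabola x) q -> segment (apex R) (parabola y) q ->
  q = apex R.
Proof.
move=> /andP[x0 x1] /andP[y0 y1] xy [s /andP[s0 s1] ->] [r /andP[r0 r1]] /=.
move=> [E1 E2].
have E3 : s * (1 + x ^+ 2) = r * (1 + y ^+ 2) by lra.
have E4 : s * ((x - y) * (1 - x * y)) = 0.
  have -> : s * ((x - y) * (1 - x * y)) =
    s * x * (1 + y ^+ 2) - s * (1 + x ^+ 2) * y by ring.
  have -> : s * x = r * y by lra.
  by rewrite E3; ring.
have xy1 : 1 - x * y != 0.
  by rewrite subr_eq0 eq_sym lt_eqF// mulr_ilt1.
move/eqP: E4; rewrite !mulf_eq0 subr_eq0 (negbTE xy) (negbTE xy1) !orbF.
by move=> /eqP ->; rewrite /apex; congr pair; ring.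
Qed.

(** The affine form whose zero set is the line through the points of abscissas x
    and y of the parabola takes the value (z - x) (z - y) at the point of
    abscissa z. *)
Lemma chord_form (R : realType) (x y s z w : R) :
  let q := ((1 - s) * z + s * w, (1 - s) * z ^+ 2 + s * w ^+ 2) in
  q.2 - (x + y) * q.1 + x * y =
  (1 - s) * ((z - x) * (z - y)) + s * ((w - x) * (w - y)).
Proof. by move=> q; rewrite /q /=; ring. Qed.

(** The parabola separates the two segments: by convexity a chord lies on or
    above it, while the spoke lies strictly below it except at its end. *)
Lemma spoke_chord (R : realType) (x y z : R) (q : R * R) :
  0 <= z < 1 ->
  segment (apex R) (parabola z) q -> segment (parabola x) (parabola y) q ->
  q = parabola z /\ (z = x \/ z = y).
Proof.
move=> /andP[z0 z1] [r /andP[r0 r1] ->] [s /andP[s0 s1]] /= [E1 E2].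
(* Both sides are the height of the common point above the parabola. *)
have above : (1 - r) * (r * z ^+ 2 - 1) = s * (1 - s) * (x - y) ^+ 2.
  have -> : (1 - r) * (r * z ^+ 2 - 1) =
    (1 - r) * -1 + r * z ^+ 2 - ((1 - r) * 0 + r * z) ^+ 2 by ring.
  by rewrite E1 E2; ring.
have above0 : 0 <= (1 - r) * (r * z ^+ 2 - 1).
  by rewrite above; apply: mulr_ge0 (sqr_ge0 _); apply: mulr_ge0; lra.
have z2 : z ^+ 2 < 1 by rewrite expr_lt1.
have rz : r * z ^+ 2 - 1 < 0.
  by rewrite subr_lt0 (le_lt_trans _ z2)// ler_piMl// sqr_ge0.
have rE : r = 1.
  by move: above0; rewrite nmulr_lge0//; lra.
subst r; split; first by rewrite /parabola; congr pair; ring.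
have zx : (z - x) * (z - y) = 0.
  have := chord_form x y s x y => /=; rewrite -E1 -E2 => E.
  have -> : (z - x) * (z - y) = (1 - 1) * -1 + 1 * z ^+ 2 -
    (x + y) * ((1 - 1) * 0 + 1 * z) + x * y by ring.
  by rewrite E; ring.
by move/eqP: zx; rewrite mulf_eq0 !subr_eq0 => /orP[] /eqP; [left|right].
Qed.

(** If the chord from z to w does not interleave with the chord from x to y,
    then z and w lie weakly on the same side of the line through x and y, so a
    common point can only come from an end lying on that line. *)
Lemma chord_chord (R : realType) (x y z w : R) (q : R * R) :
  x < y -> z != w ->
  (x < z < y -> x <= w <= y) -> (x < w < y -> x <= z <= y) ->
  segment (parabola x) (parabola y) q -> segment (parabola z) (parabola w) q ->
  [\/ q = parabola z /\ (z = x \/ z = y), q = parabola w /\ (w = x \/ w = y),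
      z = x /\ w = y | z = y /\ w = x].
Proof.
move=> xy zw zwxy wzxy [r _ qr] [s /andP[s0 s1] qs].
have E : (1 - s) * ((z - x) * (z - y)) + s * ((w - x) * (w - y)) = 0.
  rewrite -chord_form /=.
  have [E1 E2] := etrans (esym qs) qr; move: E1 E2 => /= -> ->; ring.
have same_side : 0 <= (z - x) * (z - y) /\ 0 <= (w - x) * (w - y) \/
    (z - x) * (z - y) <= 0 /\ (w - x) * (w - y) <= 0.
  have inside v : x <= v <= y -> (v - x) * (v - y) <= 0.
    by move=> /andP[xv vy]; apply: mulr_ge0_le0; lra.
  have outside v : ~~ (x < v < y) -> 0 <= (v - x) * (v - y).
    rewrite negb_and -!leNgt => /orP[vx|yv].
      by apply: mulr_le0; lra.
    by apply: mulr_ge0; lra.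
  have [zin|zout] := boolP (x < z < y).
    by right; split; apply: inside; [lra|exact: zwxy].
  have [win|wout] := boolP (x < w < y).
    by right; split; apply: inside; [exact: wzxy|lra].
  by left; split; apply: outside.
have {E same_side}[zE wE] : (1 - s) * ((z - x) * (z - y)) = 0 /\
    s * ((w - x) * (w - y)) = 0.
  have s1' : 0 <= 1 - s by lra.
  case: same_side => -[A B].
    by have := mulr_ge0 s1' A; have := mulr_ge0 s0 B; lra.
  by have := mulr_ge0_le0 s1' A; have := mulr_ge0_le0 s0 B; lra.
have rootE v : (v - x) * (v - y) = 0 -> v = x \/ v = y.
  by move/eqP; rewrite mulf_eq0 !subr_eq0 => /orP[] /eqP; [left|right].
have [s0'|sn0] := eqVneq s 0.
  subst s; constructor 1; split; last by apply: rootE; lra.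
  by rewrite qs /parabola /=; congr pair; ring.
have [s1'|sn1] := eqVneq s 1.
  subst s; constructor 2; split; last by apply: rootE; lra.
  by rewrite qs /parabola /=; congr pair; ring.
move/eqP: wE; rewrite mulf_eq0 (negbTE sn0) /= => /eqP/rootE wE.
move/eqP: zE; rewrite mulf_eq0 subr_eq0 eq_sym (negbTE sn1) /= => /eqP/rootE zE.
case: zE zw => -> zw; case: wE zw => -> zw.
- by rewrite eqxx in zw.
- by constructor 3.
- by constructor 4.
- by rewrite eqxx in zw.
Qed.

(** * A linear layout without interleaving edges *)

Lemma gap_above (R : realType) (f : nat -> R) (x : R) (n : nat) :
  x < 1 -> exists2 u, x < u <= 1 & forall m, (m < n)%N -> f m <= x \/ u <= f m.
Proof.
move=> x1; elim: n => [|n [u /andP[xu u1] fu]]; first by exists 1; [lra|].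
have [fx|xf] := leP (f n) x.
  exists u; first by lra.
  by move=> m; rewrite ltnS leq_eqVlt => /orP[/eqP ->|/fu//]; left.
exists (Num.min u (f n)); first by rewrite lt_min xu xf /= ge_min u1.
move=> m; rewrite ltnS leq_eqVlt => /orP[/eqP ->|/fu [|um]].
- by right; rewrite ge_min lexx orbT.
- by left.
- by right; rewrite ge_min um.
Qed.

Lemma two_between (R : realType) (x u : R) :
  x < u -> exists v w, [/\ x < v, v < w & w < u].
Proof.
by move=> xu; exists (x + (u - x) / 3), (x + 2 * (u - x) / 3); split; lra.
Qed.

(** In the next three lemmas, the interval [x, w] holds a cluster of points and
    all other points are at most x or at least u > w. Whichever of
    the pairs a, b and c, d lies in the cluster, the two do not interleave. *)
Lemma straddle_cluster (R : realType) (x w u a b c d : R) :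
  w < u -> a <= x \/ u <= a -> b <= x \/ u <= b ->
  x <= c <= w -> x <= d <= w -> a < c < b -> a <= d <= b.
Proof. by move=> wu [] ? [] ?; lra. Qed.

Lemma avoid_cluster (R : realType) (x w u a b c : R) :
  w < u -> x <= a <= w -> x <= b <= w -> c <= x \/ u <= c -> ~~ (a < c < b).
Proof. by move=> wu ? ? [] ?; lra. Qed.

Lemma cluster_ends (R : realType) (x v w a b c d : R) :
  x < v -> v < w ->
  [\/ a = x, a = v | a = w] -> [\/ b = x, b = v | b = w] ->
  [\/ c = x, c = v | c = w] -> x <= d <= w -> a < c < b -> a <= d <= b.
Proof. by move=> xv vw [] -> [] -> [] ->; lra. Qed.

(** As the children of 2 k and 2 k + 1 are out of range, the new edges are
    those of the triangle of k and its children. *)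
Lemma heap_adj_last_family (k i j : nat) :
  (0 < k)%N -> (0 < i < k.+1.*2)%N -> (0 < j < k.+1.*2)%N -> heap_adj i j ->
  ((0 < i < k.*2)%N /\ (0 < j < k.*2)%N) \/
  [\/ i = k, i = k.*2 | i = k.*2.+1] /\ [\/ j = k, j = k.*2 | j = k.*2.+1].
Proof.
move=> k0 ir jr; rewrite /heap_adj => ij.
have [ik|ik] := ltnP i k.*2; have [jk|jk] := ltnP j k.*2.
+ by left; lia.
+ right; split.
    by constructor 1; lia.
  by have [->|?] := eqVneq j k.*2; [constructor 2|constructor 3; lia].
+ right; split; last by constructor 1; lia.
  by have [->|?] := eqVneq i k.*2; [constructor 2|constructor 3; lia].
+ right; split.
    by have [->|?] := eqVneq i k.*2; [constructor 2|constructor 3; lia].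
  by have [->|?] := eqVneq j k.*2; [constructor 2|constructor 3; lia].
Qed.

(** The last clause says that no two edges interleave: adjacency is symmetric, so
    edges a b with t a < t b and edges c d with c between a and b suffice. *)
Definition heap_layout (R : realType) (n : nat) (t : nat -> R) : Prop :=
  [/\ forall i, (0 < i < n)%N -> 0 <= t i < 1,
      forall i j, (0 < i < n)%N -> (0 < j < n)%N -> t i = t j -> i = j &
      forall a b c d, (0 < a < n)%N -> (0 < b < n)%N ->
        (0 < c < n)%N -> (0 < d < n)%N -> heap_adj a b -> heap_adj c d ->
        t a < t c < t b -> t a <= t d <= t b].

(** The children of k are inserted immediately after k: then k, 2 k and 2 k + 1
    are consecutive, and all three lie weakly on the same side of each end
    of an old edge. *)
Lemma heap_layout_exists (R : realType) (k : nat) :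
  exists t : nat -> R, heap_layout k.+1.*2 t.
Proof.
elim: k => [|k0 [t [t01 tinj tnc]]].
  exists (fun=> 0); split=> [i _|i j ir jr _|a b c d _ _ _ _ _ _]; [lra|lia|lra].
set k := k0.+1 in t01 tinj tnc *.
have k2 : (0 < k < k.*2)%N by rewrite /k; lia.
have /andP[tk0 tk1] := t01 k k2.
have [u /andP[tku u1] tu] := gap_above t k.*2 tk1.
have [u1' [u2' [xu1 u12 u2u]]] := two_between tku.
pose t' i := if i == k.*2 then u1' else if i == k.*2.+1 then u2' else t i.
have t'1 : t' k.*2 = u1' by rewrite /t' eqxx.
have t'2 : t' k.*2.+1 = u2' by rewrite /t' eqxx; case: eqP => //; lia.
have t'old i : (i < k.*2)%N -> t' i = t i.
  by move=> ik; rewrite /t'; do 2?[case: eqP; first by lia].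
have t'k : t' k = t k by apply: t'old; lia.
have cases i : (0 < i < k.+1.*2)%N ->
    [\/ (0 < i < k.*2)%N, i = k.*2 | i = k.*2.+1].
  move=> ik; have [?|?] := ltnP i k.*2; first by constructor 1; lia.
  by have [?|?] := eqVneq i k.*2; [constructor 2|constructor 3; lia].
exists t'; split.
- move=> i /cases[ik|->|->]; rewrite ?t'1 ?t'2; [|lra|lra].
  by rewrite t'old; [apply: t01|lia].
- have old_new i : (0 < i < k.*2)%N -> t' i <> u1' /\ t' i <> u2'.
    move=> /andP[_ ik]; rewrite t'old//.
    by case: (tu i ik) => ?; split; lra.
  have u12' : u1' <> u2' by lra.
  move=> i j /cases[ir|->|->] /cases[jr|->|->]; rewrite ?t'1 ?t'2 => // E.
  + by apply: tinj => //; move: E; rewrite !t'old//; lia.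
  + by have [] := old_new i ir.
  + by have [] := old_new i ir.
  + by case: (old_new j jr) => /(_ (esym E)).
  + by case: (old_new j jr) => _ /(_ (esym E)).
  + by case: u12'.
- move=> a b c d ar br cr dr ab cd.
  have triE i : [\/ i = k, i = k.*2 | i = k.*2.+1] ->
      [\/ t' i = t k, t' i = u1' | t' i = u2'].
    by case=> ->; rewrite ?t'k ?t'1 ?t'2;
      [constructor 1|constructor 2|constructor 3].
  have triI i : [\/ i = k, i = k.*2 | i = k.*2.+1] -> t k <= t' i <= u2'.
    by move=> /triE[] ->; rewrite ?lexx ?(ltW xu1) ?(ltW u12) ?(ltW (lt_trans xu1 u12)).
  have gap i : (0 < i < k.*2)%N -> t' i <= t k \/ u <= t' i.
    by move=> /andP[_ ik]; rewrite t'old//; apply: tu.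
  have kpos : (0 < k)%N by [].
  case: (heap_adj_last_family kpos ar br ab) => -[ao bo];
    case: (heap_adj_last_family kpos cr dr cd) => -[co do_].
  + have [[? ?] [? ?]] := (andP ao, andP bo); have [[? ?] [? ?]] := (andP co, andP do_).
    by rewrite !t'old//; apply: tnc.
  + exact: straddle_cluster u2u (gap a ao) (gap b bo) (triI c co) (triI d do_).
  + by move=> tc; case/negP: (avoid_cluster u2u (triI a ao) (triI b bo) (gap c co)).
  + exact: cluster_ends xu1 u12 (triE a ao) (triE b bo) (triE c co) (triI d do_).
Qed.

(** * Planarity *)

Lemma set2_eqE (T : finType) (x y u v : T) :
  [set x; y]%SET = [set u; v]%SET -> x = u /\ y = v \/ x = v /\ y = u.
Proof.
move=> E.
have := set21 x y; rewrite E => /set2P hx.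
have := set22 x y; rewrite E => /set2P hy.
have := set21 u v; rewrite -E => /set2P hu.
have := set22 u v; rewrite -E => /set2P hv.
by move: hx hy hu hv => [] ? [] ? [] ? [] ?; subst; auto.
Qed.

Lemma edge_of_edges (G : sgraph) (x y : G) :
  [set x; y]%SET \in edges G -> edge x y.
Proof.
case/imsetP => -[u v]; rewrite inE /= => uv /set2_eqE[[-> ->]//|[-> ->]].
by rewrite edge_sym.
Qed.

(** A vertex z lying on an edge is a common point of that edge and of any edge at
    z, so the crossing condition also keeps edges away from other vertices. *)
Lemma straight_planar (R : realType) (G : sgraph) (pos : G -> R * R) :
  injective pos -> (forall x : G, exists y, edge x y) ->
  (forall (a b c d : G) (q : R * R), edge a b -> edge c d ->
    [set a; b]%SET != [set c; d]%SET ->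
    segment (pos a) (pos b) q -> segment (pos c) (pos d) q ->
    exists v, [/\ q = pos v, v \in [set a; b]%SET & v \in [set c; d]%SET]) ->
  planar R G.
Proof.
move=> pos_inj nbr cross.
pose curve (e : {set G}) : set (R * R) := [set q | exists a b : G,
  e = [set a; b]%SET /\ segment (pos a) (pos b) q]%classic.
have curveE a b : curve [set a; b]%SET = segment (pos a) (pos b).
  apply/seteqP; split=> q; last by exists a, b.
  by move=> [u [v [/set2_eqE[[-> ->]//|[-> ->]]]]]; rewrite segmentC.
have curve_meet e f : e \in edges G -> f \in edges G -> e != f ->
    (curve e `&` curve f `<=` pos @` [set` (e :&: f)%SET])%classic.
  move=> eG fG ef q [[a [b [eE qab]]] [c [d [fE qcd]]]]; subst e f.
  have [v [-> vab vcd]] :=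
    cross a b c d q (edge_of_edges eG) (edge_of_edges fG) ef qab qcd.
  by exists v => //=; rewrite inE vab vcd.
exists pos, curve; split=> //.
- move=> x y xy; rewrite curveE; apply: segment_arc.
  by apply: contraTneq xy => /pos_inj ->; rewrite edge_irrefl.
- move=> e z eG zpos; have [w zw] := nbr z.
  have [->|ezw] := eqVneq e [set z; w]%SET; first by rewrite set21.
  have zwG : [set z; w]%SET \in edges G by apply/imsetP; exists (z, w); rewrite ?inE.
  have zwpos : curve [set z; w]%SET (pos z).
    rewrite curveE; exists 0; first by rewrite lexx ler01.
    by rewrite subr0 !mul1r !mul0r !addr0; case: (pos z).
  have [v /= vin /pos_inj vz] := curve_meet _ _ eG zwG ezw _ (conj zpos zwpos).
  by move: vin; rewrite vz inE => /andP[].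
Qed.

Definition heap_position (R : realType) (t : nat -> R) (i : nat) : R * R :=
  if i == 0 then apex R else parabola (t i).

(** An edge is either a spoke from 0 or a chord of the parabola, and two chords
    do not cross because the layout does not interleave their ends. *)
Lemma heap_crossing (R : realType) (n : nat) (t : nat -> R)
    (a b c d : nat) (q : R * R) :
  heap_layout n t -> (a < n)%N -> (b < n)%N -> (c < n)%N -> (d < n)%N ->
  heap_adj a b -> heap_adj c d ->
  ~ (a = c /\ b = d) -> ~ (a = d /\ b = c) ->
  segment (heap_position t a) (heap_position t b) q ->
  segment (heap_position t c) (heap_position t d) q ->
  exists v, [/\ q = heap_position t v, v = a \/ v = b & v = c \/ v = d].
Proof.
move=> [t01 tinj tnc].
have tneq i j : (0 < i < n)%N -> (0 < j < n)%N -> i != j -> t i != t j.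
  by move=> ir jr; apply: contraNneq => /(tinj i j ir jr) ->.
(* Orient each edge so that a spoke starts at 0 and a chord goes to the right. *)
pose oriented i j := (i == 0%N) && (0 < j)%N || [&& (0 < i)%N, (0 < j)%N & t i < t j].
have orientedP i j : (i < n)%N -> (j < n)%N -> heap_adj i j ->
    oriented i j || oriented j i.
  move=> ilt jlt ij; rewrite /oriented.
  have [i0|i0] := posnP i; first by move: ij; rewrite /heap_adj; lia.
  have [j0|j0] := posnP j; first by lia.
  have : t i != t j by apply: tneq; rewrite ?i0 ?j0//; move: ij => /andP[].
  by rewrite neq_lt; case/orP => ->; rewrite ?orbT.
move=> an bn cn dn; wlog oab : a b an bn / oriented a b.
  move=> W ab cd n1 n2 qab qcd; case/orP: (orientedP a b an bn ab) => o.
    exact: W.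
  have [| |||||v [qv [va|va] vcd]] := W b a bn an o; rewrite ?(heap_adj_sym b)//.
  - by move=> [? ?]; apply: n2.
  - by move=> [? ?]; apply: n1.
  - by rewrite segmentC.
  - by exists v; split=> //; right.
  - by exists v; split=> //; left.
wlog ocd : c d cn dn / oriented c d.
  move=> W ab cd n1 n2 qab qcd; case/orP: (orientedP c d cn dn cd) => o.
    exact: W.
  have [| |||||v [qv vab [vc|vc]]] := W d c dn cn o; rewrite ?(heap_adj_sym d)//.
  - by rewrite segmentC.
  - by exists v; split=> //; right.
  - by exists v; split=> //; left.
move=> ab cd n1 n2.
have posE i : (0 < i)%N -> heap_position t i = parabola (t i).
  by move=> i0; rewrite /heap_position gtn_eqF.
case/orP: oab => [/andP[/eqP a0 b0]|/and3P[a0 b0 tab]];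
  case/orP: ocd => [/andP[/eqP c0 d0]|/and3P[c0 d0 tcd]].
- subst a c; rewrite (posE b)// (posE d)// => qb qd; exists 0%N; split; [|by left|by left].
  apply: spoke_spoke qb qd; [apply: t01; lia|apply: t01; lia|].
  by apply: tneq; lia.
- subst a; rewrite (posE b)// (posE c)// (posE d)// => qb qcd.
  have [|-> tb] := spoke_chord _ qb qcd; first by apply: t01; lia.
  exists b; rewrite posE//; split=> //; first by right.
  by case: tb => /tinj; [left|right]; lia.
- subst c; rewrite (posE a)// (posE b)// (posE d)// => qab qd.
  have [|-> td] := spoke_chord _ qd qab; first by apply: t01; lia.
  exists d; rewrite posE//; split=> //; last by right.
  by case: td => /tinj; [left|right]; lia.
- rewrite !posE// => qab qcd.
  have ir : [/\ (0 < a < n)%N, (0 < b < n)%N, (0 < c < n)%N & (0 < d < n)%N].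
    by split; lia.
  case: ir => ar br cr dr.
  have [|||[-> tc]|[-> td]|[tca tdb]|[tcb tda]] := chord_chord tab _ _ _ qab qcd.
  + by apply: tneq => //; case/andP: cd.
  + exact: tnc.
  + by apply: tnc; rewrite // heap_adj_sym.
  + exists c; rewrite posE//; split=> //; last by left.
    by case: tc => /tinj; [left|right]; lia.
  + exists d; rewrite posE//; split=> //; last by right.
    by case: td => /tinj; [left|right]; lia.
  + by case: n1; split; apply: tinj.
  + by case: n2; split; apply: tinj.
Qed.

Lemma heap_planar (R : realType) (n : nat) :
  (1 < n)%N -> planar R (heap_graph n).
Proof.
move=> n1; have [t lay] := heap_layout_exists R n.
have {}lay : heap_layout n t.
  case: lay => t01 tinj tnc; split.
  - by move=> i ir; apply: t01; lia.
  - by move=> i j ir jr; apply: tinj; lia.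
  - by move=> a b c d ar br cr dr; apply: tnc; lia.
case: (lay) => t01 tinj _.
apply: (@straight_planar _ _ (fun i : heap_graph n => heap_position t i)).
- move=> i j; rewrite /heap_position; case: eqP => i0; case: eqP => j0.
  + by move=> _; apply: val_inj; rewrite /= i0 j0.
  + by move/apex_neq_parabola.
  + by move/esym/apex_neq_parabola.
  + move=> [tij _]; apply: val_inj; apply: tinj tij => /=.
      by rewrite ltn_ord andbT lt0n; apply/eqP.
    by rewrite ltn_ord andbT lt0n; apply/eqP.
- move=> i; have [i0|i0] := eqVneq (val i) 0%N.
    by exists (Ordinal n1); rewrite /= /heap_adj -[nat_of_ord i]/(val i) i0.
  exists (Ordinal (ltnW n1)); rewrite /= /heap_adj -[nat_of_ord i]/(val i).
  by rewrite (negbTE i0) orbT.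
- move=> a b c d q ab cd abcd qab qcd.
  have [| |v [qv vab vcd]] := heap_crossing lay (ltn_ord a) (ltn_ord b)
    (ltn_ord c) (ltn_ord d) ab cd _ _ qab qcd.
  + by move=> [/val_inj ac /val_inj bd]; rewrite ac bd eqxx in abcd.
  + by move=> [/val_inj ad /val_inj bc]; rewrite ad bc finset.setUC eqxx in abcd.
  have [w vw wab] : exists2 w : heap_graph n, v = val w & w \in [set a; b]%SET.
    by case: vab => ->; [exists a|exists b]; rewrite ?set21 ?set22.
  exists w; split=> //; first by rewrite qv vw.
  by apply/set2P; case: vcd; rewrite vw => /val_inj ->; [left|right].
Qed.

Theorem mainTheorem5 (R : realType) (eps : R) (heps : 0 < eps) :
  exists G : sgraph,
    [/\ tough (1 : R) G, chordal G, planar R G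
      & (longest_path_order G)%:R < #|G|%:R `^ eps].
Proof.
(* The order (2 ^ (m * g)) `^ eps is at least 2 ^ g, while paths have at most
   8 * m * g + 7 vertices. *)
have [m m0 meps] : exists2 m : nat, (0 < m)%N & 1 <= m%:R * eps.
  exists (Num.truncn eps^-1).+1 => //.
  by rewrite -ler_pdivrMr// mul1r ltW// truncnS_gt.
have [g g0 gexp] : exists2 g, (0 < g)%N & ((8 * m + 7) * g < 2 ^ g)%N.
  by apply: linear_lt_exp2; lia.
exists (heap_graph (2 ^ (m * g))); split.
- exact: heap_tough.
- exact: heap_chordal.
- by apply: heap_planar; rewrite -{1}(expn0 2) ltn_exp2l// muln_gt0 m0.
rewrite card_ord; apply: (@lt_le_trans _ _ (2 ^ g)%:R).
  rewrite ltr_nat (leq_ltn_trans (heap_longest_path _))//.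
  by apply: leq_ltn_trans gexp; nia.
rewrite !natrX -!powR_mulrn// -powRrM; apply: ler_powR; first by rewrite ler1n.
by rewrite natrM mulrAC ler_peMl.
Qed.
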